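(* Let $n \geq 2$ and let $p=(p_1,\ldots,p_n) \in (0,1)^n$ with $\sum_{i=1}^n p_i = 1$. Let $\lambda \in [0,1]$ and define $p'=(p_1,\ldots,p_{n-2},p'_{n-1},p'_n)$ by $p'_{n-1} = \lambda p_{n-1} + (1-\lambda) p_n$ and $p'_{n} = (1-\lambda) p_{n-1} + \lambda p_n$. Then for all $c=1,\ldots,n$ we have $T_{c,n}(p') \leq_{\rm st} T_{c,n}(p)$.
   Context: For a vector $p=(p_1,\ldots,p_n)$ with nonnegative entries and $\sum_{i=1}^n p_i \leq 1$, set $p_0 = 1-\sum_{i=1}^n p_i$. At each discrete time $1,2,\ldots$ a coupon is drawn independently, with replacement, from $\{0,1,\ldots,n\}$, coupon $i$ being drawn with probability $p_i$ (coupon $0$ is a ''null coupon'' that never counts toward the collection). For $1 \leq c \leq n$, $T_{c,n}(p)$ denotes the number of draws needed until, for the first time, $c$ distinct coupons among $\{1,\ldots,n\}$ have been obtained. For real random variables $X,Y$, $X \leq_{\rm st} Y$ means $\Pr\{X>t\} \leq \Pr\{Y>t\}$ for all real $t$. *)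

(* Defs.v *)
From HB Require Import structures.
From mathcomp Require Import all_boot all_order all_algebra.
From mathcomp Require Import all_classical all_reals all_analysis.

Set Implicit Arguments.
Unset Strict Implicit.
Unset Printing Implicit Defensive.

Import Order.TTheory GRing.Theory Num.Theory.
Local Open Scope classical_set_scope.
Local Open Scope ring_scope.

(* The outcomes {0, ..., n} of a draw, with the discrete sigma-algebra.  [ord0]
   is the null coupon; [lift ord0 i], whose value is i + 1, is the proper coupon
   indexed by [i : 'I_n]. *)
Definition coupon (n : nat) := 'I_n.+1.

HB.instance Definition _ (n : nat) := Finite.on (coupon n).
HB.instance Definition _ (n : nat) := isPointed.Build (coupon n) ord0.
HB.instance Definition _ (n : nat) :=
  @isMeasurable.Build default_measure_display (coupon n)
    discrete_measurable discrete_measurable0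
    discrete_measurableC discrete_measurableU.

Definition coupon_prob (R : realType) (n : nat) (p : 'I_n -> R)
    (x : coupon n) : R :=
  if unlift ord0 x is Some i then p i else 1 - \sum_(i < n) p i.

Definition mutually_independent d (Omega : measurableType d) (R : realType)
    (P : probability Omega R) d' (S : measurableType d')
    (X : nat -> {RV P >-> S}) : Prop :=
  forall (J : seq nat) (B : nat -> set S),
    uniq J -> (forall k, measurable (B k)) ->
    P (\bigcap_(k in [set` J]) (X k @^-1` B k)) =
    (\prod_(k <- J) P (X k @^-1` B k))%E.

(* Time is shifted by one: [X k] is the draw made at time k + 1. *)
Definition coupon_draws d (Omega : measurableType d) (R : realType)
    (P : probability Omega R) (n : nat) (p : 'I_n -> R)
    (X : nat -> {RV P >-> coupon n}) : Prop :=
  (forall k x, distribution P (X k) [set x] = (coupon_prob p x)%:E) /\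
  mutually_independent X.

Definition collected (Omega : Type) (n : nat) (X : nat -> Omega -> coupon n)
    (m : nat) (w : Omega) : {set 'I_n} :=
  [set i : 'I_n | [exists k : 'I_m, X k w == lift ord0 i]]%SET.

(* The value is +oo when [c] distinct coupons are never obtained. *)
Definition collection_time (R : realType) (Omega : Type) (n : nat)
    (X : nat -> Omega -> coupon n) (c : nat) (w : Omega) : \bar R :=
  ereal_inf [set (m%:R)%:E | m in [set m : nat | (c <= #|collected X m w|)%N]].

(* The two variables may live on different probability spaces. *)
Definition st_le (R : realType)
    d1 (Omega1 : measurableType d1) (P1 : probability Omega1 R)
    (Y1 : Omega1 -> \bar R)
    d2 (Omega2 : measurableType d2) (P2 : probability Omega2 R)
    (Y2 : Omega2 -> \bar R) : Prop :=
  forall t : R, (P1 [set w | t%:E < Y1 w] <= P2 [set w | t%:E < Y2 w])%E.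

Definition mix_entries (R : realType) (n : nat) (lambda : R) (a b : 'I_n)
    (p : 'I_n -> R) : 'I_n -> R :=
  fun i => if i == a then lambda * p a + (1 - lambda) * p b
           else if i == b then (1 - lambda) * p a + lambda * p b
           else p i.

(* Main.v *)
(* For every m, the probability that m draws show fewer than c coupons has to
   decrease when p is replaced by p'.  Group the draws of the two mixed coupons
   a and b: given that exactly s >= 1 of the m draws are a or b, and given the
   other draws, this probability depends on p_a and p_b only through p_a + p_b,
   which is unchanged, and, with a nonnegative coefficient, through
   p_a^s + p_b^s (the draws show only one of the two coupons), which decreases
   under mixing because x^s is convex. *)

Require Import Defs.
From HB Require Import structures.
From mathcomp Require Import all_boot all_order all_algebra.
From mathcomp Require Import all_classical all_reals all_analysis.
From mathcomp Require Import zify ring lra.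

Set Implicit Arguments.
Unset Strict Implicit.
Unset Printing Implicit Defensive.

Import Order.TTheory GRing.Theory Num.Theory.
Local Open Scope classical_set_scope.
Local Open Scope ring_scope.

(** * Convexity of powers and the effect of mixing on [short_prob] *)

Lemma exprn_convex (R : realDomainType) (t x y : R) (s : nat) :
  0 <= t <= 1 -> 0 <= x -> 0 <= y ->
  (t * x + (1 - t) * y) ^+ s <= t * x ^+ s + (1 - t) * y ^+ s.
Proof.
move=> /andP[t0 t1] x0 y0; elim: s => [|s IHs].
  by rewrite !expr0; lra.
have t'0 : 0 <= 1 - t by rewrite subr_ge0.
(* Chebyshev's inequality for two points: [x] and [x ^+ s] are ordered alike. The gap left by the
   induction step is the covariance of the two under the weights [t] and [1 - t]. *)
have cheb : 0 <= (x - y) * (x ^+ s - y ^+ s).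
  have [xy|/ltW yx] := leP x y.
    by rewrite mulr_le0 // subr_le0 // lerXn2r ?nnegrE.
  by rewrite mulr_ge0 // subr_ge0 // lerXn2r ?nnegrE.
have w0 : 0 <= t * x + (1 - t) * y by rewrite addr_ge0 // mulr_ge0.
rewrite exprS (le_trans (ler_wpM2l w0 IHs)) // !exprS -subr_ge0.
have -> : t * (x * x ^+ s) + (1 - t) * (y * y ^+ s) -
   (t * x + (1 - t) * y) * (t * x ^+ s + (1 - t) * y ^+ s) =
   t * (1 - t) * ((x - y) * (x ^+ s - y ^+ s)) by ring.
by rewrite mulr_ge0 ?cheb // mulr_ge0.
Qed.

(* Probability that fewer than [c] coupons are collected after [m] more draws,
   starting from the collection [A]. *)
Fixpoint short_prob (R : pzRingType) (n : nat) (p : 'I_n -> R) (c m : nat)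
    (A : {set 'I_n}) : R :=
  if m is m'.+1 then \sum_(i < n) p i * short_prob p c m' (i |: A)
  else (#|A| < c)%N%:R.

(* Contribution to [short_prob] of [s >= 1] draws of [a] or [b], taken before
   [m] further draws: the [s] draws are all [a], all [b], or show both coupons. *)
Definition short_prob_pair (R : pzRingType) (n : nat) (p : 'I_n -> R)
    (c : nat) (a b : 'I_n) (m s : nat) (A : {set 'I_n}) : R :=
  p a ^+ s * short_prob p c m (a |: A) + p b ^+ s * short_prob p c m (b |: A)
  + ((p a + p b) ^+ s - p a ^+ s - p b ^+ s)
    * short_prob p c m (a |: (b |: A)).

Lemma sum_split2 (R : nmodType) (n : nat) (a b : 'I_n) (F : 'I_n -> R) :
  a != b ->
  \sum_i F i = \sum_(i | (i != a) && (i != b)) F i + (F a + F b).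
Proof.
move=> ab; rewrite (bigD1 a) //= (bigD1 b) 1?eq_sym //= [RHS]addrC -addrA.
by [].
Qed.

(** Split on the next draw. One outside the pair enlarges [A]; one inside it raises [s], and
    whatever it adds to the case where both coupons are shown makes up the new mixed coefficient. *)
Lemma short_prob_pairS (R : comPzRingType) (n : nat) (p : 'I_n -> R)
    (c : nat) (a b : 'I_n) (m s : nat) (A : {set 'I_n}) : a != b ->
  short_prob_pair p c a b m.+1 s A =
  \sum_(i | (i != a) && (i != b)) p i * short_prob_pair p c a b m s (i |: A)
  + short_prob_pair p c a b m s.+1 A.
Proof.
move=> ab; rewrite /short_prob_pair /= !(sum_split2 _ ab).
have setU1K x (B : {set 'I_n}) : x |: (x |: B) = x |: B.
  by rewrite finset.setUA finset.setUid.
have setU1C x y (B : {set 'I_n}) : x |: (y |: B) = y |: (x |: B).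
  exact: finset.setUCA.
rewrite (setU1C b a) !setU1K (setU1C b a (b |: A)) setU1K.
under [in RHS]eq_bigr => i _ do rewrite (setU1C b i) !(setU1C a i) !mulrDr
  !(mulrCA (p i)).
rewrite !big_split /= -!mulr_sumr !exprS.
ring.
Qed.

(** Induction on [m] with [s] free, since unfolding a draw raises it. At [m = 0] everything depends
    on which of [#|A|.+1] and [#|A|.+2] stay below [c]: if both, the sum is [(p a + p b) ^+ s]; if
    only the first, it is [p a ^+ s + p b ^+ s]; otherwise 0. *)
Lemma short_prob_pair_le (R : realDomainType) (n : nat) (p q : 'I_n -> R)
    (c : nat) (a b : 'I_n) (m s : nat) (A : {set 'I_n}) :
  a != b -> a \notin A -> b \notin A ->
  (forall i, 0 <= p i) -> (forall i, i != a -> i != b -> q i = p i) ->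
  q a + q b = p a + p b ->
  (forall s, q a ^+ s + q b ^+ s <= p a ^+ s + p b ^+ s) ->
  short_prob_pair q c a b m s A <= short_prob_pair p c a b m s A.
Proof.
move=> ab aA bA p0 qp qpab qs.
elim: m s A aA bA => [|m IHm] s A aA bA; last first.
  rewrite !short_prob_pairS // lerD ?IHm //.
  apply: ler_sum => i /andP[ia ib]; rewrite qp // ler_wpM2l // IHm //.
    by rewrite in_setU1 negb_or eq_sym ia.
  by rewrite in_setU1 negb_or eq_sym ib.
rewrite /short_prob_pair /= !cardsU1 in_setU1 (negbTE aA) (negbTE bA).
rewrite (negbTE ab) /= !add1n qpab; have := qs s.
case: (ltnP _.+2 c) => [lt2|_].
  by rewrite (ltnW lt2) !mulr1; lra.
by case: ltnP => _; rewrite ?mulr1 ?mulr0; lra.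
Qed.

Lemma short_prob_le (R : realDomainType) (n : nat) (p q : 'I_n -> R)
    (c : nat) (a b : 'I_n) (m : nat) (A : {set 'I_n}) :
  a != b -> a \notin A -> b \notin A ->
  (forall i, 0 <= p i) -> (forall i, i != a -> i != b -> q i = p i) ->
  q a + q b = p a + p b ->
  (forall s, q a ^+ s + q b ^+ s <= p a ^+ s + p b ^+ s) ->
  short_prob q c m A <= short_prob p c m A.
Proof.
move=> ab aA bA p0 qp qpab qs.
elim: m A aA bA => [//|m IHm] A aA bA /=.
(* A first draw of [a] or [b] is the case [s = 1] of [short_prob_pair], where the mixed coefficient
   vanishes; any other first draw is left to the induction hypothesis. *)
rewrite !(sum_split2 _ ab) lerD //; last first.
  have := short_prob_pair_le c m 1 ab aA bA p0 qp qpab qs.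
  have sub2 x y : x + y - x - y = 0 :> R by ring.
  by rewrite /short_prob_pair !expr1 !sub2 !mul0r !addr0.
apply: ler_sum => i /andP[ia ib]; rewrite qp // ler_wpM2l // IHm //.
  by rewrite in_setU1 negb_or eq_sym ia.
by rewrite in_setU1 negb_or eq_sym ib.
Qed.

(** * The growing collection and its waiting time *)

Definition add_coupon (n : nat) (x : coupon n) (A : {set 'I_n}) : {set 'I_n} :=
  if unlift ord0 x is Some i then i |: A else A.

Lemma collected0 (Omega : Type) (n : nat) (X : nat -> Omega -> coupon n)
    (w : Omega) : collected X 0 w = finset.set0.
Proof. by apply/setP => i; rewrite !inE; apply/existsP => -[[]]. Qed.

Lemma collectedS (Omega : Type) (n : nat) (X : nat -> Omega -> coupon n)
    (m : nat) (w : Omega) :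
  collected X m.+1 w = add_coupon (X m w) (collected X m w).
Proof.
have lastE i : (i \in collected X m.+1 w) =
    (X m w == lift ord0 i) || (i \in collected X m w).
  rewrite !inE; apply/existsP/idP => [[k Xk]|/orP[Xm|/existsP[k Xk]]].
  - have [km|mk] := ltnP k m.
      by apply/orP; right; apply/existsP; exists (Ordinal km).
    have -> : m = k by apply/eqP; rewrite eqn_leq mk -ltnS ltn_ord.
    by rewrite Xk.
  - by exists ord_max.
  - by exists (widen_ord (leqnSn m) k).
apply/setP => i; rewrite lastE /add_coupon; case: unliftP => [j ->|->].
  by rewrite (inj_eq lift_inj) in_setU1 eq_sym.
by rewrite (negbTE (neq_lift _ _)).
Qed.

Lemma leq_card_collected (Omega : Type) (n : nat) (X : nat -> Omega -> coupon n)
    (m k : nat) (w : Omega) :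
  (m <= k)%N -> (#|collected X m w| <= #|collected X k w|)%N.
Proof.
move=> mk; apply/subset_leq_card/fintype.subsetP => i; rewrite !inE.
by move=> /existsP[j Xj]; apply/existsP; exists (widen_ord mk j).
Qed.

(** The collection only grows, so if it is short after [Num.trunc t] draws, every [m] in the infimum
    is at least [(Num.trunc t).+1], which exceeds [t]. *)
Lemma collection_time_gt (R : realType) (Omega : Type) (n : nat)
    (X : nat -> Omega -> coupon n) (c : nat) (w : Omega) (t : R) : 0 <= t ->
  (t%:E < collection_time R X c w)%E
  = (#|collected X (Num.trunc t) w| < c)%N.
Proof.
move=> t0; have /andP[tt tlt] := truncn_itv t0.
rewrite [RHS]ltnNge; apply/idP/negP => [lt_t le_c|lt_c].
  have : (collection_time R X c w <= (Num.trunc t)%:R%:E)%E.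
    apply: ge_ereal_inf; exists (Num.trunc t)%:R%:E => //.
    by exists (Num.trunc t).
  by move=> /(lt_le_trans lt_t); rewrite lte_fin ltNge tt.
apply: (@lt_le_trans _ _ (Num.trunc t).+1%:R%:E); first by rewrite lte_fin.
apply/ereal_infP => _ [m /= le_c <-]; rewrite lee_fin ler_nat ltnNge.
apply/negP => le_m; apply: lt_c.
by apply: leq_trans le_c (leq_card_collected _ _ _).
Qed.

Lemma collection_time_ge0 (R : realType) (Omega : Type) (n : nat)
    (X : nat -> Omega -> coupon n) (c : nat) (w : Omega) :
  (0 <= collection_time R X c w)%E.
Proof. by apply/ereal_infP => _ [m _ <-]; rewrite lee_fin. Qed.

(** The null coupon has probability 0 here; this matches a genuine draw with the recursion of
    [short_prob], which sums over proper coupons. *)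
Lemma sum_add_coupon (R : realType) (n : nat) (p : 'I_n -> R)
    (f : {set 'I_n} -> R) (A : {set 'I_n}) : \sum_i p i = 1 ->
  \sum_(x : coupon n) coupon_prob p x * f (add_coupon x A)
  = \sum_i p i * f (i |: A).
Proof.
move=> p1; rewrite big_ord_recl /coupon_prob unlift_none p1 subrr mul0r add0r.
by apply: eq_bigr => i _; rewrite /add_coupon liftK.
Qed.

(** * From independent draws to [short_prob] *)

Lemma bigsetU_preimage (T : Type) (I : finType) (f : T -> I)
    (E : I -> set T) :
  \big[setU/set0]_(x : I) (E x `&` f @^-1` [set x]) = [set w | E (f w) w].
Proof.
rewrite -bigcup_seq; apply/seteqP; split => w /=.
  by move=> [x _ [Ew /= fw]]; rewrite fw.
by move=> Ew; exists (f w) => //=; rewrite mem_index_enum.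
Qed.

Lemma probability_partition d (Omega : measurableType d) (R : realType)
    (P : probability Omega R) (n : nat) (Y : {RV P >-> coupon n})
    (E : set Omega) : measurable E ->
  (P E = \sum_(x : coupon n) P (E `&` Y @^-1` [set x]))%E.
Proof.
move=> mE; have mY x : measurable (E `&` Y @^-1` [set x]).
  exact/measurableI/measurable_funPTI.
rewrite -(@measure_bigsetU_ord _ _ _ P n.+1 xpredT); last 2 first.
- exact: mY.
- by move=> x y _ _ [w [[_ /= <-] [_ /= <-]]].
by congr (P _); rewrite bigsetU_preimage.
Qed.

(** [Q] is arbitrary because splitting on the last draw [x] replaces it by [Q] composed with
    [add_coupon x]. *)
Lemma measurable_collected d (Omega : measurableType d) (R : realType)
    (P : probability Omega R) (n : nat) (X : nat -> {RV P >-> coupon n})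
    (m : nat) (Q : pred {set 'I_n}) :
  measurable [set w | Q (collected X m w)].
Proof.
elim: m Q => [|m IHm] Q.
  under eq_fun do rewrite collected0.
  by case: (Q _); [rewrite set_true|rewrite set_false].
under eq_fun do rewrite collectedS.
rewrite -(bigsetU_preimage (X m)
  (fun x => [set w | Q (add_coupon x (collected X m w))])).
apply: bigsetU_measurable => x _; apply: measurableI; last exact: measurable_funPTI.
exact: (IHm (fun A => Q (add_coupon x A))).
Qed.

(** Fixing a prefix [s] of outcomes replaces conditioning: independence is used only for the
    cylinder event, whose probability is a product. Induction on [m] lengthens the prefix. *)
Lemma prob_prefix_short d (Omega : measurableType d) (R : realType)
    (P : probability Omega R) (n : nat) (p : 'I_n -> R)
    (X : nat -> {RV P >-> coupon n}) (c m : nat) (s : seq (coupon n)) :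
  \sum_i p i = 1 -> coupon_draws p X ->
  P ([set w | forall k, (k < size s)%N -> X k w = nth ord0 s k] `&`
     [set w | #|collected X (size s + m) w| < c]%N) =
  (\prod_(x <- s) coupon_prob p x *
    short_prob p c m (foldl (fun A x => add_coupon x A) finset.set0 s))%:E.
Proof.
move=> p1 [Xp Xind].
pose pre (s : seq (coupon n)) :=
  [set w | forall k, (k < size s)%N -> X k w = nth ord0 s k].
have preE r : pre r =
    \bigcap_(k in [set` iota 0 (size r)]) (X k @^-1` [set nth ord0 r k]).
  apply/seteqP; split => w /= h k.
    by rewrite /= mem_iota /= add0n => /h.
  by move=> kr; apply: h; rewrite /= mem_iota.
have mpre r : measurable (pre r).
  rewrite preE bigcap_seq; apply: bigsetI_measurable => k _.
  exact: measurable_funPTI.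
have Ppre r : P (pre r) = (\prod_(x <- r) coupon_prob p x)%:E.
  rewrite preE Xind ?iota_uniq // -prodEFin (big_nth ord0) /index_iota subn0.
  by apply: eq_bigr => k _; rewrite -(Xp k).
have preS r x : pre (rcons r x) = pre r `&` X (size r) @^-1` [set x].
  apply/seteqP; split => w /=; rewrite /pre /= size_rcons.
    move=> h; split => [k kr|]; last by rewrite h // nth_rcons ltnn eqxx.
    by rewrite h ?nth_rcons ?kr // ltnW.
  move=> [h xw] k; rewrite ltnS leq_eqVlt nth_rcons => /predU1P[->|kr].
    by rewrite ltnn eqxx.
  by rewrite kr h.
elim: m s => [|m IHm] s; rewrite -/(pre s).
  (* The prefix determines the collection, so with no further draws the event is either the whole
     cylinder or empty. *)
  have collE r w : pre r w ->
      collected X (size r) w = foldl (fun A x => add_coupon x A) finset.set0 r.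
    elim/last_ind: r => [|r x IHr]; first by rewrite collected0.
    rewrite preS => -[prw xw].
    by rewrite size_rcons collectedS -cats1 foldl_cat /= IHr // xw.
  rewrite addn0 /=; case: ltnP => [lt_c|le_c].
    rewrite mulr1 -Ppre; congr (P _); apply/setIidPl => w /collE /= ->.
    exact: lt_c.
  rewrite mulr0; transitivity (P set0); last exact: measure0.
  congr (P _); apply/seteqP; split => // w.
  by move=> [/collE /= ->]; rewrite ltnNge le_c.
rewrite (probability_partition (X (size s))); last first.
  apply: measurableI; first exact: mpre.
  exact: (measurable_collected X _ (fun A => #|A| < c)%N).
rewrite /= -(sum_add_coupon _ _ p1) mulr_sumr -sumEFin.
apply: eq_bigr => x _.
have := IHm (rcons s x); rewrite -/(pre _) preS size_rcons addSnnS setIAC => ->.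
by rewrite -cats1 foldl_cat big_cat /= big_seq1 mulrA.
Qed.

Lemma prob_short d (Omega : measurableType d) (R : realType)
    (P : probability Omega R) (n : nat) (p : 'I_n -> R)
    (X : nat -> {RV P >-> coupon n}) (c m : nat) :
  \sum_i p i = 1 -> coupon_draws p X ->
  P [set w | #|collected X m w| < c]%N = (short_prob p c m finset.set0)%:E.
Proof.
move=> p1 hX; have := prob_prefix_short c m [::] p1 hX.
rewrite big_nil mul1r /= => <-; congr (P _).
by apply/seteqP; split => w //= [].
Qed.

Theorem theorem1 (R : realType) (n : nat) (hn : (2 <= n)%N)
    (p : 'I_n -> R) (hp01 : forall i : 'I_n, 0 < p i < 1)
    (hpsum : \sum_(i < n) p i = 1)
    (lambda : R) (hlambda : 0 <= lambda <= 1)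
    (a b : 'I_n) (ha : nat_of_ord a = (n - 2)%N) (hb : nat_of_ord b = (n - 1)%N)
    (d : measure_display) (Omega : measurableType d) (P : probability Omega R)
    (X : nat -> {RV P >-> coupon n}) (hX : coupon_draws p X)
    (d' : measure_display) (Omega' : measurableType d')
    (P' : probability Omega' R) (X' : nat -> {RV P' >-> coupon n})
    (hX' : coupon_draws (mix_entries lambda a b p) X')
    (c : nat) (hc : (1 <= c <= n)%N) :
  st_le P' (collection_time R X' c) P (collection_time R X c).
Proof.
have ab : a != b by apply/eqP => /(congr1 val) /=; lia.
have q1 : \sum_i mix_entries lambda a b p i = 1.
  rewrite -hpsum !(sum_split2 _ ab); congr (_ + _).
    apply: eq_bigr => i /andP[/negbTE ia /negbTE ib].
    by rewrite /mix_entries ia ib.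
  by rewrite /mix_entries !eqxx eq_sym (negbTE ab); ring.
move=> t; have [t0|t_lt0] := leP 0 t; last first.
  (* For negative [t] both events are the whole space, as collection times are nonnegative. *)
  have st_setT (O : Type) (Y : nat -> O -> coupon n) :
      [set w | t%:E < collection_time R Y c w]%E = setT.
    apply/seteqP; split => w //= _.
    by rewrite (lt_le_trans _ (collection_time_ge0 _ _ _ _)) // lte_fin.
  by rewrite !st_setT !probability_setT.
under eq_fun do rewrite (collection_time_gt _ _ _ t0).
under [X in (_ <= P X)%E]eq_fun do rewrite (collection_time_gt _ _ _ t0).
rewrite (prob_short _ _ q1 hX') (prob_short _ _ hpsum hX) lee_fin.
have p0 i : 0 <= p i by have /andP[/ltW] := hp01 i.
apply: (short_prob_le c _ ab); rewrite ?inE //.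
- by move=> i /negbTE ia /negbTE ib; rewrite /mix_entries ia ib.
- by rewrite /mix_entries !eqxx eq_sym (negbTE ab); ring.
move=> s; rewrite /mix_entries !eqxx eq_sym (negbTE ab).
have conv := exprn_convex s hlambda.
(* Convexity is used once for each mixed entry; the swapped weights add up to 1 on each of
   [p a ^+ s] and [p b ^+ s]. *)
have := lerD (conv _ _ (p0 a) (p0 b)) (conv _ _ (p0 b) (p0 a)).
rewrite (addrC (lambda * p b)) => /le_trans; apply.
by rewrite le_eqVlt; apply/orP; left; apply/eqP; ring.
Qed.
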